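(* Let $H$ be an $\ell$-partite $\ell$-uniform hypergraph with parts of size at most $r$. There is a constant $c=c(r,\ell)>0$ such that for every integer $k\ge 2$ $$R\bigl(H,\lfloor ck/\log k\rfloor\bigr)\le R_{\mathrm{list}}(H,k)\le R(H,k).$$ In particular, if $\mathrm{ex}(H,n)=\tilde{\Theta}(n^{\ell-\varepsilon(H)})$ (as $n\to\infty$) for some $\varepsilon(H)>0$, then, as $k\to\infty$, $$R_{\mathrm{list}}(H,k)=\tilde{\Theta}(R(H,k))=\tilde{\Theta}(k^{1/\varepsilon(H)}).$$
   Context: $K_n^{(\ell)}$ is the complete $\ell$-uniform hypergraph on $n$ vertices. For an $\ell$-uniform hypergraph $H$ and an integer $k$, the ordinary Ramsey number $R(H,k)$ is the smallest $n$ such that every colouring of $E(K_n^{(\ell)})$ with the colours $\{1,\dots,k\}$ contains a monochromatic copy of $H$ (a not necessarily induced subhypergraph isomorphic to $H$ all of whose edges have the same colour). Given an assignment $L$ of a set $L_e\subseteq\mathbb{N}$ to each edge $e$ of $K_n^{(\ell)}$, an $L$-colouring is a function $c:E(K_n^{(\ell)})\to\mathbb{N}$ with $c(e)\in L_e$ for all $e$. The list Ramsey number $R_{\mathrm{list}}(H,k)$ is the smallest $n$ for which there exists an assignment $L$ of lists with $|L_e|=k$ for every $e\in E(K_n^{(\ell)})$ such that every $L$-colouring of $E(K_n^{(\ell)})$ contains a monochromatic copy of $H$. An $\ell$-uniform hypergraph is $\ell$-partite if its vertex set can be partitioned into $\ell$ parts such that every edge contains exactly one vertex from each part. $\mathrm{ex}(H,n)$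 denotes the maximum number of edges in an $\ell$-uniform hypergraph on $n$ vertices containing no copy of $H$. $f=\tilde{\Theta}(g)$ means that $f$ and $g$ are equal up to polylogarithmic factors. Logarithms are natural. *)

(* Defs.v *)
From HB Require Import structures.
From mathcomp Require Import all_boot all_order all_algebra finmap.
From mathcomp Require Import all_classical all_reals all_analysis.
Set Implicit Arguments.
Unset Strict Implicit.
Unset Printing Implicit Defensive.
Import Order.TTheory GRing.Theory Num.Theory.
Import numFieldNormedType.Exports.

(* A hypergraph on the vertex set V is given by its edge set, a term of type
   {set {set V}}; isolated vertices of V are part of the hypergraph. *)

Definition uniform (l : nat) (V : finType) (H : {set {set V}}) : bool :=
  [forall e in H, #|e| == l].

Definition complete (l n : nat) : {set {set 'I_n}} :=
  [set e : {set 'I_n} | #|e| == l].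

(* Parts are the fibres of p; a part may be empty, which can only happen when
   H has no edges. *)
Definition partite_with_parts_le (l r : nat) (V : finType)
    (H : {set {set V}}) : Prop :=
  exists p : V -> 'I_l,
    (forall e, e \in H -> forall i : 'I_l, #|[set v in e | p v == i]| = 1%N) /\
    (forall i : 'I_l, (#|[set v | p v == i]| <= r)%N).

Definition embedding (V : finType) (n : nat) (H : {set {set V}})
    (G : {set {set 'I_n}}) (f : {ffun V -> 'I_n}) : bool :=
  injectiveb f && [forall e in H, f @: e \in G].

Definition contains_copy (V : finType) (n : nat) (H : {set {set V}})
    (G : {set {set 'I_n}}) : bool :=
  [exists f : {ffun V -> 'I_n}, embedding H G f].

(* Colourings of the edges of the complete l-uniform hypergraph on n vertices
   are functions on all subsets of 'I_n whose values outside [complete l n]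
   are unconstrained and never used. *)
Definition has_mono_copy (l : nat) (V : finType) (n : nat) (H : {set {set V}})
    (c : {set 'I_n} -> nat) : bool :=
  [exists f : {ffun V -> 'I_n}, embedding H (complete l n) f &&
    [forall e in H, forall e' in H, c (f @: e) == c (f @: e')]].

(* The default value 0 is taken only when P has no element; by Ramsey's theorem
   this does not occur for the two predicates below when H is l-uniform. *)
Definition least (P : nat -> Prop) : nat :=
  xget 0%N [set n | P n /\ forall m, P m -> (n <= m)%N]%classic.

Definition ramsey_property (l : nat) (V : finType) (H : {set {set V}})
    (k n : nat) : Prop :=
  forall c : {set 'I_n} -> nat,
    (forall e, e \in complete l n -> (1 <= c e <= k)%N) ->
    has_mono_copy l H c.

Definition ramsey (l : nat) (V : finType) (H : {set {set V}}) (k : nat) : nat :=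
  least (ramsey_property l H k).

Definition list_ramsey_property (l : nat) (V : finType) (H : {set {set V}})
    (k n : nat) : Prop :=
  exists L : {set 'I_n} -> {fset nat},
    (forall e, e \in complete l n -> #|` L e|%fset = k) /\
    forall c : {set 'I_n} -> nat,
      (forall e, e \in complete l n -> c e \in L e) ->
      has_mono_copy l H c.

Definition list_ramsey (l : nat) (V : finType) (H : {set {set V}})
    (k : nat) : nat :=
  least (list_ramsey_property l H k).

Definition ex_number (l : nat) (V : finType) (H : {set {set V}})
    (n : nat) : nat :=
  \max_(G : {set {set 'I_n}} | uniform l G && ~~ contains_copy H G) #|G|.

Local Open Scope ring_scope.

Definition soft_theta (R : realType) (f g : nat -> R) : Prop :=
  exists (C : R) (a : nat), 0 < C /\
    \forall n \near \oo%classic,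
      f n <= C * ln n%:R ^+ a * g n /\ g n <= C * ln n%:R ^+ a * f n.

(* Main.v *)
Require Import Defs.
From HB Require Import structures.
From mathcomp Require Import all_boot all_order all_fingroup all_algebra finmap.
From mathcomp Require Import all_classical all_reals all_analysis.
From mathcomp Require Import ring lra zify.
Set Implicit Arguments.
Unset Strict Implicit.
Unset Printing Implicit Defensive.
Import Order.TTheory GRing.Theory Num.Theory.
Import numFieldNormedType.Exports.

(** The bound of the list Ramsey number by the Ramsey number is the case of
    constant lists.  For the converse put m = floor (c k / ln k) and let lists
    of size k witness the list Ramsey property at n; the claim is that every
    colouring c0 of the complete hypergraph with m colours has a monochromatic
    copy of H.  Map the list colours independently and uniformly at random to
    the m colours.  A given edge e has no list colour that is sent to c0 e with
    probability (1 - 1/m)^k <= exp (- k/m), which is at most a large negative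
    power of k.  If n is polynomial in k, a union bound over the at most n^l
    edges gives one map that serves all edges, hence a colouring from the lists
    that refines c0, and its monochromatic copy is monochromatic for c0
    ([ramsey_of_list]).  If n exceeds that polynomial bound, then n already has
    the Ramsey property, because Ramsey numbers of l-partite hypergraphs are
    polynomial in the number of colours ([ramsey_polynomial]).  An iterated
    pigeonhole argument ([mono_box]) is enough for this, as the value of the
    exponent only affects the constant c.

    For the asymptotic part, let M = 'C(n, l).  A k-colouring of the complete
    hypergraph has a colour class with at least M / k edges, so the Ramsey
    property can fail only if M <= k ex(H, n) ([ramsey_of_density]).
    Conversely, about M ln M / ex(H, n) random permuted images of an extremal
    H-free hypergraph cover all edges, and colouring each edge by an image that
    contains it avoids monochromatic copies, so the Ramsey property implies
    k ex(H, n) <= M ln M ([ramsey_colours_le]).  With ex(H, n) of order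
    n^(l - eps) up to logarithms and M of order n^l, both inequalities say that
    n^eps is k up to logarithms of n; by the polynomial bound these are
    logarithms of k.  This gives the order of the Ramsey number, and the
    comparison of the first part transfers the lower estimate to the list
    Ramsey number, since c k / ln k is k up to a logarithm.

    Both random choices are instances of one counting lemma, [union_bound],
    and [expected_misses_lt1] is the estimate that makes it apply. *)

(** * Least elements and pigeonhole *)

Lemma least_le (P : nat -> Prop) (n : nat) : P n -> (least P <= n)%N.
Proof.
move=> Pn; rewrite /least; case: xgetP => [m -> [_ h]|_]; first exact: h.
exact: leq0n.
Qed.

Lemma least_spec (P : nat -> Prop) : (exists n, P n) -> P (least P).
Proof.
case=> n0 Pn0; rewrite /least; case: xgetP => [m -> []//|none].
have ex : exists n, `[< P n >] by exists n0; apply/asboolP.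
case: (ex_minnP ex) => m /asboolP Pm mmin; case: (none m); split => // p Pp.
by apply: mmin; apply/asboolP.
Qed.

Lemma large_fibre (X Y : finType) (D : {set X}) (f : X -> Y) (q : nat) :
  (q * #|Y| < #|D|)%N -> exists y, (q < #|[set x in D | f x == y]|)%N.
Proof.
move=> lt; apply/existsP; apply: contraLR lt => /existsPn small.
rewrite -leqNgt.
rewrite -sum1_card (partition_big f xpredT) //= mulnC -sum_nat_const.
apply: leq_sum => y _; rewrite sum1dep_card; have := small y.
by rewrite -leqNgt; congr (_ <= _)%N; apply: eq_card => x; rewrite !inE.
Qed.

(** * Polynomial bound on Ramsey numbers of l-partite hypergraphs *)

(** The recursion is the one that the pigeonhole step of [mono_box] dictates:
    a side s for dimension l leads to the side r m s^(r l) for dimension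
    l + 1, and s = (r m)^B. *)
Fixpoint box_exponent (r l : nat) : nat :=
  if l is l'.+1 then (1 + box_exponent r l' * (r * l'))%N else 0%N.

(** Every m-colouring of a grid of dimension l whose sides are polynomial in m
    has a monochromatic r x ... x r subgrid.  Induction on l: each value of the
    first coordinate yields a subgrid of dimension l and a colour; the
    possible pairs number at most s^(r l) m, with s the side for dimension l,
    so among r times as many first coordinates some r yield the same pair. *)
Lemma mono_box (r m l : nat) (chi : seq nat -> 'I_m) : (0 < r)%N ->
  exists (A : 'I_l -> 'I_r -> nat) (col : 'I_m),
    [/\ forall i j, (A i j < (r * m) ^ box_exponent r l)%N,
        forall i, injective (A i) &
        forall J : 'I_l -> 'I_r, chi [seq A i (J i) | i <- enum 'I_l] = col].
Proof.
move=> r0; have m0 : (0 < m)%N := leq_ltn_trans (leq0n _) (ltn_ord (chi [::])).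
elim: l chi => [|l IHl] chi.
  exists (fun=> fun=> 0%N), (chi [::]); split=> [[]|[]|J] //.
  by rewrite enum_ord0.
set s := ((r * m) ^ box_exponent r l)%N in IHl.
have s0 : (0 < s)%N by rewrite expn_gt0 muln_gt0 r0 m0.
have sE : ((r * m) ^ box_exponent r l.+1 = r * (m * s ^ (l * r)))%N.
  by rewrite /= expnD expn1 expnM mulnA [(l * r)%N]mulnC.
set S := ((r * m) ^ box_exponent r l.+1)%N in sE *.
have sS : (s <= S)%N.
  rewrite leq_pexp2l ?muln_gt0 ?r0 //=; case: (l) => //= l'.
  by rewrite leqW // leq_pmulr // muln_gt0 r0.
pose Y : finType := ({ffun 'I_l * 'I_r -> 'I_s} * 'I_m)%type.
have good (v : 'I_S) : exists y : Y,
    (forall i, injective (fun j => y.1 (i, j))) /\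
    (forall J : 'I_l -> 'I_r,
      chi ((v : nat) :: [seq (y.1 (i, J i) : nat) | i <- enum 'I_l]) = y.2).
  have [A [col [ltA injA monoA]]] := IHl (fun t => chi ((v : nat) :: t)).
  exists ([ffun ij => Ordinal (ltA ij.1 ij.2)], col); split=> [i j j'|J] /=.
    by rewrite !ffunE => -[]; apply: injA.
  rewrite -[RHS](monoA J); congr (chi (_ :: _)).
  by apply: eq_map => i; rewrite ffunE.
have [y yP] := fin_all_exists good.
(* The pair (B, col) is the subgrid and colour shared by r first coordinates. *)
have [[B col] fib] : exists b, (r.-1 < #|[set v in [set: 'I_S] | y v == b]|)%N.
  apply: large_fibre; rewrite cardsT card_prod card_ffun card_prod !card_ord sE.
  by rewrite [(_ * m)%N]mulnC ltn_pmul2r ?prednK // muln_gt0 m0 expn_gt0 s0.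
rewrite prednK // in fib.
pose w (j : 'I_r) : 'I_S := enum_val (widen_ord fib j).
have wE j : y (w j) = (B, col).
  by have := enum_valP (widen_ord fib j); rewrite !inE => /eqP.
have w_inj : injective w by move=> j j' /enum_val_inj [/val_inj].
exists (fun i j => if unlift ord0 i is Some i' then (B (i', j) : nat) else w j).
exists col; split=> [i j|i j j'|J].
- case: unliftP => [i'|] _; last exact: ltn_ord.
  exact: leq_trans (ltn_ord _) sS.
- case: unliftP => [i'|] _; last by move/val_inj/w_inj.
  have [injB _] := yP (w j); rewrite wE /= in injB.
  by move/val_inj/injB.
- have [_ /(_ (fun i => J (lift ord0 i)))] := yP (w (J ord0)).
  rewrite wE /= => <-; rewrite enum_ordSl /= unlift_none -map_comp.
  by congr (chi (_ :: _)); apply: eq_map => i /=; rewrite liftK.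
Qed.

Lemma rank_in_fibre (V I : finType) (p : V -> I) (r : nat) :
  (forall i, (#|[set v | p v == i]| <= r)%N) ->
  exists j : V -> 'I_r, forall u v, p u = p v -> j u = j v -> u = v.
Proof.
move=> small; pose part v := enum [set u | p u == p v].
have mem_part v : v \in part v by rewrite mem_enum inE.
have lt_r v : (index v (part v) < r)%N.
  by apply: leq_trans (small (p v)); rewrite cardE index_mem.
exists (fun v => Ordinal (lt_r v)) => u v Euv [].
have Ep : part u = part v by rewrite /part Euv.
by rewrite Ep => /index_inj -> //; rewrite -Ep.
Qed.

Lemma embedded_edge (l : nat) (V : finType) (n : nat) (H : {set {set V}})
    (f : {ffun V -> 'I_n}) (e : {set V}) :
  uniform l H -> injective f -> e \in H -> f @: e \in complete l n.
Proof.
by move=> /forall_inP uH injf eH; rewrite inE card_imset // uH.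
Qed.

(** Cut l N vertices into l blocks of N consecutive ones and colour a point of
    the grid [N]^l by the colour of the edge with one vertex in each block that
    it describes.  A monochromatic r x ... x r subgrid is a monochromatic
    complete l-partite hypergraph with parts of size r, and H embeds in it part
    by part. *)
Lemma ramsey_of_partite (l r : nat) (V : finType) (H : {set {set V}})
    (m n : nat) :
  uniform l H -> partite_with_parts_le l r H -> (0 < r)%N -> (0 < m)%N ->
  (l * (r * m) ^ box_exponent r l <= n)%N -> ramsey_property l H m n.
Proof.
move=> uH [p [transv small]] r0; case: m => // m _.
set N := (_ ^ _)%N => leNn c cP.
have N0 : (0 < N)%N by rewrite expn_gt0 muln_gt0 r0.
have [j jP] := rank_in_fibre small.
pose edge (s : seq nat) : {set 'I_n} :=
  [set z : 'I_n | [exists i : 'I_l, (z : nat) == i * N + nth 0 s i]]%N.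
(* Colours lie in 1..m+1 and are shifted down to fit in 'I_m.+1. *)
have [A [col [ltA injA monoA]]] :=
  @mono_box r m.+1 l (fun s => inord (c (edge s)).-1) r0.
have ltf v : (p v * N + A (p v) (j v) < n)%N.
  apply: leq_trans leNn; apply: (@leq_trans ((p v).+1 * N)); last first.
    by rewrite leq_mul2r ltn_ord orbT.
  by rewrite mulSn addnC ltn_add2r ltA.
pose f := [ffun v => Ordinal (ltf v)].
have injf : injective f.
  move=> u v; rewrite !ffunE => -[] E.
  have Ep : p u = p v.
    apply/val_inj; have := congr1 (divn^~ N) E.
    by rewrite /= !divnMDl // !divn_small ?addn0 ?ltA.
  by apply: (jP _ _ Ep); move: E; rewrite Ep => /addnI/injA.
have col_edge e : e \in H -> c (f @: e) = col.+1.
  move=> eH.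
  have rep (i : 'I_l) : exists v, (v \in e) && (p v == i).
    have /eqP/cards1P[v /setP/(_ v)] := transv e eH i.
    by rewrite !inE eqxx => vP; exists v.
  have [v vP] := fin_all_exists rep.
  have vE u : u \in e -> u = v (p u).
    move=> ue; have /eqP/cards1P[w /setP wE] := transv e eH (p u).
    have := wE u; have := wE (v (p u)).
    by rewrite !inE vP ue eqxx => /esym/eqP-> /esym/eqP->.
  have Ee : f @: e = edge [seq A i (j (v i)) | i <- enum 'I_l].
    have nthE (i : 'I_l) :
        nth 0%N [seq A i (j (v i)) | i <- enum 'I_l] i = A i (j (v i)).
      by rewrite (nth_map i) ?size_enum_ord // nth_ord_enum.
    apply/setP=> z; rewrite inE; apply/imsetP/existsP => [[u ue ->]|[i]].
      by exists (p u); rewrite nthE ffunE /= -vE.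
    rewrite nthE => /eqP zE; have /andP[vie /eqP pvi] := vP i.
    by exists (v i) => //; apply/val_inj; rewrite ffunE /= zE pvi.
  have /andP[c1 cm] := cP _ (embedded_edge uH injf eH).
  rewrite -(monoA (fun i => j (v i))) -Ee inordK ?prednK //.
apply/existsP; exists f; apply/andP; split.
  apply/andP; split; first exact/injectiveP.
  by apply/forall_inP => e eH; exact: embedded_edge uH injf eH.
by apply/forall_inP => e eH; apply/forall_inP => e' e'H; rewrite !col_edge.
Qed.

(** * Random choices *)

(** The probabilistic method in counting form: choose phi uniformly among all
    functions, so that e fails when phi i is bad for every i.  The hypothesis
    says that the expected number of failing e is less than one. *)
Lemma union_bound (T I Y : finType) (E : {set T}) (bad : T -> I -> {set Y}) :
  (\sum_(e in E) \prod_(i : I) #|bad e i| < #|Y| ^ #|I|)%N ->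
  exists phi : {ffun I -> Y}, forall e, e \in E ->
    exists i, phi i \notin bad e i.
Proof.
move=> lt.
pose Bad e := [set phi : {ffun I -> Y} | [forall i, phi i \in bad e i]].
have cardBad e : #|Bad e| = (\prod_i #|bad e i|)%N.
  have -> : #|Bad e| = #|family (fun i => mem (bad e i))|.
    by apply: eq_card => phi; rewrite inE.
  by rewrite card_family foldrE big_map big_enum.
have : (#|\bigcup_(e in E) Bad e| < #|{ffun I -> Y}|)%N.
  rewrite card_ffun; apply: leq_ltn_trans lt.
  elim/big_ind2: _ => [|A a B b leA leB|e _]; last by rewrite cardBad.
    by rewrite cards0.
  by apply: leq_trans (leq_add leA leB); rewrite leq_card_setU.
rewrite ltnNge => notall.
have /existsP[phi phiP] : [exists phi, phi \notin \bigcup_(e in E) Bad e].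
  apply: contraR notall => /existsPn all; apply: subset_leq_card.
  by apply/fintype.subsetP => phi _; have := all phi; rewrite negbK.
exists phi => e eE; apply/existsP; rewrite -negb_forall.
by apply: contra phiP => allbad; apply/bigcupP; exists e => //; rewrite inE.
Qed.

Lemma card_ord_fset (M : nat) (A : {fset nat}) :
  (forall s, s \in A -> (s < M)%N) ->
  #|[set i : 'I_M | (i : nat) \in A]| = #|` A|%fset.
Proof.
move=> ltM; rewrite cardE -(size_map val); apply: perm_size; apply: uniq_perm.
- by rewrite map_inj_uniq ?enum_uniq //; apply: val_inj.
- exact: fset_uniq.
move=> s; apply/mapP/idP => [[i]|sA]; first by rewrite mem_enum inE => ? ->.
by exists (Ordinal (ltM s sA)); rewrite // mem_enum inE.
Qed.

Lemma card_complete (l n : nat) : #|complete l n| = 'C(n, l).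
Proof. by rewrite card_draws card_ord. Qed.

(** Let the list colours be among 0..M-1.  Of the m^M functions from these to
    the m colours, (m - 1)^k m^(M - k) send no list colour of a given edge e to
    c e.  A function phi for which this happens at no edge provides a colouring
    c' from the lists such that phi sends c' e to c e for every edge e, so
    monochromatic copies for c' are monochromatic for c. *)
Lemma ramsey_of_list (l : nat) (V : finType) (H : {set {set V}}) (k m n : nat) :
  uniform l H -> (0 < m)%N -> ('C(n, l) * m.-1 ^ k < m ^ k)%N ->
  list_ramsey_property l H k n -> ramsey_property l H m n.
Proof.
move=> uH; case: m => // m _ /= ltm [L [cardL LP]] c cP.
pose M := (\max_(e in complete l n) \max_(s <- L e) s).+1.
have ltM e s : e \in complete l n -> s \in L e -> (s < M)%N.
  move=> eK sL; rewrite ltnS; apply: leq_trans (leq_bigmax_cond _ eK).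
  exact: (@leq_bigmax_seq _ _ xpredT id).
pose bad (e : {set 'I_n}) (s : 'I_M) : {set 'I_m.+1} :=
  if (s : nat) \in L e then [set~ inord (c e).-1]%SET else [set: 'I_m.+1]%SET.
have card_bad e : e \in complete l n ->
    (\prod_s #|bad e s| = m ^ k * m.+1 ^ (M - k))%N.
  move=> eK; pose S := [set s : 'I_M | (s : nat) \in L e].
  have cardS : #|S| = k by rewrite card_ord_fset ?cardL // => s; apply: ltM.
  rewrite (bigID (mem S)) /=; congr (_ * _)%N.
    rewrite -cardS -prod_nat_const; apply: eq_bigr => s.
    by rewrite inE /bad => ->; rewrite cardsC1 card_ord.
  have -> : (M - k)%N = #|~: S| by rewrite cardsCs finset.setCK cardS card_ord.
  rewrite -prod_nat_const; apply: eq_big => s; first by rewrite finset.in_setC.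
  by rewrite inE /bad => /negbTE->; rewrite cardsT card_ord.
(* An edge is needed below, to see that k <= M. *)
have [e0 e0K|K0] := pickP (mem (complete l n)); last first.
  by apply: LP => e; have := K0 e => /= ->.
have leM : (k <= M)%N.
  rewrite -(cardL e0 e0K) -(@card_ord_fset M) => [|s]; last exact: ltM.
  by rewrite -[leqRHS]card_ord max_card.
have [|phi phiP] := @union_bound _ 'I_M 'I_m.+1 (complete l n) bad.
  rewrite (eq_bigr _ card_bad) sum_nat_const card_complete !card_ord mulnA.
  by rewrite -[in ltnRHS](subnKC leM) expnD ltn_pmul2r // expn_gt0.
have pick_colour e : exists s : nat, e \in complete l n ->
    s \in L e /\ exists2 i : 'I_M, s = i & c e = (phi i).+1.
  have [eK|] := boolP (e \in complete l n); last by exists 0%N.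
  have [s] := phiP e eK; rewrite /bad.
  case: ifP => [sL|_]; last by rewrite inE.
  rewrite in_setC1 negbK => /eqP phis.
  exists s => _; split=> //; exists s => //.
  have /andP[c1 cm] := cP e eK.
  by rewrite phis inordK ?prednK.
have [c' c'P] := fin_all_exists pick_colour.
have /existsP[f /andP[/andP[injf fK] /forall_inP mono]] :
  has_mono_copy l H c' by apply: LP => e /c'P[].
apply/existsP; exists f; rewrite /embedding injf fK /=.
apply/forall_inP => e eH; apply/forall_inP => e' e'H.
have [_ [i ci ->]] := c'P _ (forall_inP fK _ eH).
have [_ [i' ci' ->]] := c'P _ (forall_inP fK _ e'H).
have /forall_inP/(_ e' e'H) := mono e eH.
by rewrite ci ci' => /eqP/val_inj ->.
Qed.

(** * Covering by copies of an extremal hypergraph *)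

(** List the elements of A and then the others, do the same for B, and match
    the two lists position by position. *)
Lemma perm_onto (T : finType) (A B : {set T}) :
  #|A| = #|B| -> exists s : {perm T}, s @: A = B.
Proof.
move=> EAB; pose lay (X : {set T}) := enum X ++ enum (~: X).
have mem_lay X x : x \in lay X.
  by rewrite mem_cat !mem_enum finset.in_setC orbN.
have uniq_lay X : uniq (lay X).
  rewrite cat_uniq !enum_uniq andbT; apply/hasPn => x.
  by rewrite !mem_enum finset.in_setC.
have size_lay X : size (lay X) = #|T|.
  by rewrite size_cat -!cardE cardsC.
pose h x := nth x (lay B) (index x (lay A)).
have lt_index x : (index x (lay A) < size (lay B))%N.
  by rewrite size_lay -(size_lay A) index_mem.
have injh : injective h.
  move=> x y; rewrite /h (set_nth_default y) // => /eqP.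
  by rewrite nth_uniq // => /eqP/index_inj->.
exists (perm injh); apply/eqP.
rewrite eqEcard card_imset ?EAB; last exact: perm_inj.
rewrite leqnn andbT; apply/fintype.subsetP => _ /imsetP[x xA ->].
rewrite permE /h /lay index_cat mem_enum xA nth_cat.
have lt : (index x (enum A) < size (enum B))%N.
  by rewrite -cardE -EAB cardE index_mem mem_enum.
by rewrite lt -mem_enum mem_nth.
Qed.

Definition covering_perms (n : nat) (G : {set {set 'I_n}}) (e : {set 'I_n}) :
    {set {perm 'I_n}} :=
  [set s : {perm 'I_n} | [exists x in G, s @: x == e]].

Lemma imset_permM (T : finType) (s t : {perm T}) (A : {set T}) :
  (s * t)%g @: A = t @: (s @: A).
Proof. by rewrite -imset_comp; apply: eq_imset => x; rewrite permM. Qed.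

(** By symmetry the number of permutations that carry some edge of G to e is
    the same for all l-sets e; summing over e counts each permutation #|G|
    times.  In other words a random permuted image of G contains a given
    l-set with probability #|G| / 'C(n, l). *)
Lemma card_covering_perms (l n : nat) (G : {set {set 'I_n}}) (e : {set 'I_n}) :
  uniform l G -> e \in complete l n ->
  ('C(n, l) * #|covering_perms G e| = #|{perm 'I_n}| * #|G|)%N.
Proof.
move=> /forall_inP uG eK.
have same e1 e2 : e1 \in complete l n -> e2 \in complete l n ->
    (#|covering_perms G e1| <= #|covering_perms G e2|)%N.
  rewrite !inE => /eqP E1 /eqP E2.
  have [t tP] : exists t : {perm 'I_n}, t @: e1 = e2.
    by apply: perm_onto; rewrite E1 E2.
  rewrite -(card_imset _ (mulIg t)); apply: subset_leq_card.
  apply/fintype.subsetP => _ /imsetP[s + ->].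
  rewrite !inE => /exists_inP[x xG /eqP sx].
  by apply/exists_inP; exists x; rewrite // imset_permM sx tP.
rewrite -card_complete -!sum_nat_const.
transitivity (\sum_(e' in complete l n) #|covering_perms G e'|)%N.
  by apply: eq_bigr => e' e'K; apply/eqP; rewrite eqn_leq !same.
transitivity (\sum_(e' in complete l n)
    \sum_(s : {perm 'I_n} | s \in covering_perms G e') 1)%N.
  by apply: eq_bigr => e' _; rewrite sum1_card.
rewrite (exchange_big_dep xpredT) //=; apply: eq_bigr => s _.
rewrite sum1dep_card -[RHS](card_imset _ (imset_inj (@perm_inj _ s))).
apply: eq_card => e'; rewrite !inE; apply/andP/imsetP.
  by move=> [_ /exists_inP[x xG /eqP <-]]; exists x.
move=> [x xG ->]; split; last by apply/exists_inP; exists x.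
by rewrite card_imset ?uG //; apply: perm_inj.
Qed.

Lemma perms_cover (l n t : nat) (G : {set {set 'I_n}}) :
  uniform l G -> ('C(n, l) * ('C(n, l) - #|G|) ^ t < 'C(n, l) ^ t)%N ->
  exists phi : {ffun 'I_t -> {perm 'I_n}}, forall e, e \in complete l n ->
    exists i, phi i \in covering_perms G e.
Proof.
move=> uG; set M := 'C(n, l) => lt.
have [/cards0_eq K0|] := posnP #|complete l n|.
  by exists [ffun=> 1%g] => e; rewrite K0 inE.
rewrite card_complete -/M => M0.
have [|phi phiP] := @union_bound _ 'I_t {perm 'I_n} (complete l n)
    (fun e _ => (~: covering_perms G e)%SET).
  rewrite -(ltn_pmul2r (_ : 0 < M ^ t)%N) ?expn_gt0 ?M0 //.
  rewrite big_distrl /= (eq_bigr (fun=> (#|{perm 'I_n}| * (M - #|G|)) ^ t)%N).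
    rewrite sum_nat_const card_complete card_ord -/M expnMn mulnCA.
    rewrite ltn_pmul2l //.
    by rewrite expn_gt0; apply/orP; left; apply/card_gt0P; exists 1%g.
  move=> e eK; rewrite prod_nat_const card_ord -expnMn; congr (_ ^ _)%N.
  rewrite [X in (X * _)%N]cardsCs finset.setCK mulnBl mulnBr.
  by rewrite -(card_covering_perms uG eK) [(M * _)%N]mulnC.
exists phi => e eK; have [i] := phiP e eK.
by rewrite finset.in_setC negbK; exists i.
Qed.

(** If t permuted images of G covered all edges, colouring each edge by the
    index of an image that contains it would violate the Ramsey property: a
    monochromatic copy of H lies in one image, and pulling it back by the
    permutation gives a copy in G. *)
Lemma copy_free_cover_bound (l : nat) (V : finType) (H : {set {set V}})
    (n t : nat) (G : {set {set 'I_n}}) :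
  uniform l G -> ~~ contains_copy H G -> ramsey_property l H t n ->
  ('C(n, l) ^ t <= 'C(n, l) * ('C(n, l) - #|G|) ^ t)%N.
Proof.
move=> uG freeG ramH; rewrite leqNgt; apply: contra freeG.
case/(perms_cover uG) => phi phiP.
pose c e :=
  if [pick i | phi i \in covering_perms G e] is Some i then i.+1 else 0%N.
have [|f /andP[/andP[/injectiveP injf fK] /forall_inP mono]] :=
    existsP (ramH c _).
  move=> e /phiP[i ci]; rewrite /c.
  case: pickP => [j _|/(_ i)]; last by rewrite ci.
  by rewrite /= ltn_ord.
(* Without edges a copy of H has no colour; the injection itself embeds H. *)
have [->|[e0 e0H]] := set_0Vmem H.
  apply/existsP; exists f; apply/andP; split; first exact/injectiveP.
  by apply/forall_inP => e; rewrite inE.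
have [i iP] : exists i, forall e,
    e \in H -> phi i \in covering_perms G (f @: e).
  have cE e : e \in H -> exists2 i : 'I_t,
      c (f @: e) = i.+1 & phi i \in covering_perms G (f @: e).
    move=> eH; have [j cj] := phiP _ (forall_inP fK _ eH).
    by rewrite /c; case: pickP => [i ci|/(_ j)]; [exists i | rewrite cj].
  have [i ci _] := cE e0 e0H; exists i => e eH.
  have [i' ci'] := cE e eH; have /forall_inP/(_ e eH) := mono e0 e0H.
  by rewrite ci ci' eqSS => /eqP/val_inj->.
apply/existsP; exists [ffun v => (phi i)^-1%g (f v)]; apply/andP; split.
  by apply/injectiveP => u v; rewrite !ffunE => /perm_inj/injf.
apply/forall_inP => e /iP; rewrite inE => /exists_inP[x xG /eqP phix].
suff -> : [ffun v => (phi i)^-1%g (f v)] @: e = x by [].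
have -> : [ffun v => (phi i)^-1%g (f v)] @: e = (phi i)^-1%g @: (f @: e).
  transitivity (((phi i)^-1%g \o f) @: e); last exact: imset_comp.
  by apply: eq_imset => v; rewrite ffunE.
by rewrite -phix -imset_permM mulgV (eq_imset _ (@perm1 _)) imset_id.
Qed.

(** Some colour class has at least 'C(n, l) / k edges; if that exceeds the
    extremal number, the class contains H. *)
Lemma ramsey_of_density (l : nat) (V : finType) (H : {set {set V}})
    (k n : nat) :
  (k * ex_number l H n < 'C(n, l))%N -> ramsey_property l H k n.
Proof.
move=> lt c cP; case: k => [|k] in lt cP *.
  rewrite mul0n -card_complete in lt; have [e /cP] := card_gt0P lt.
  by case: (c e).
have [|i fib] := @large_fibre _ 'I_k.+1 (complete l n)
    (fun e => inord (c e).-1) (ex_number l H n).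
  by rewrite card_ord mulnC card_complete.
set G := [set e in _ | _] in fib.
have cG e : e \in G -> c e = i.+1.
  rewrite !inE => /andP[eK /eqP <-].
  have /andP[c1 ck] : (1 <= c e <= k.+1)%N by apply: cP; rewrite inE.
  by rewrite inordK ?prednK.
have GK e : e \in G -> e \in complete l n by rewrite inE => /andP[].
have : contains_copy H G.
  apply: contraLR fib => freeG; rewrite -leqNgt; apply: leq_bigmax_cond.
  by rewrite freeG andbT; apply/forall_inP => e /GK; rewrite inE.
case/existsP=> f /andP[injf /forall_inP fG]; apply/existsP; exists f.
apply/andP; split.
  by rewrite /embedding injf; apply/forall_inP => e /fG/GK.
by apply/forall_inP => e eH; apply/forall_inP => e' e'H; rewrite !cG ?fG.
Qed.

Lemma ramsey_property_mono (l : nat) (V : finType) (H : {set {set V}})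
    (k n n' : nat) :
  uniform l H -> (n <= n')%N -> ramsey_property l H k n ->
  ramsey_property l H k n'.
Proof.
move=> uH le ramH c cP; pose w := widen_ord le.
have injw : injective w by move=> x y [] /val_inj.
have [|f /andP[/andP[/injectiveP injf fK] /forall_inP mono]] :=
    existsP (ramH (fun e => c (w @: e)) _).
  by move=> e; rewrite inE => eK; apply: cP; rewrite inE card_imset.
pose g := [ffun v => w (f v)].
have injg : injective g by move=> u v; rewrite !ffunE => /injw/injf.
have gE (e : {set V}) : g @: e = w @: (f @: e).
  by rewrite -imset_comp; apply: eq_imset => v; rewrite ffunE.
apply/existsP; exists g; apply/andP; split.
  apply/andP; split; first exact/injectiveP.
  by apply/forall_inP => e eH; exact: embedded_edge uH injg eH.
apply/forall_inP => e eH; apply/forall_inP => e' e'H; rewrite !gE.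
exact: (forall_inP (mono e eH)).
Qed.

(** The constant lists 1..k. *)
Lemma list_of_ramsey (l : nat) (V : finType) (H : {set {set V}}) (k n : nat) :
  ramsey_property l H k n -> list_ramsey_property l H k n.
Proof.
move=> ramH; exists (fun=> [fset s in iota 1 k]%fset); split=> [e _|c cP].
  by rewrite card_fseq undup_id ?size_iota // iota_uniq.
apply: ramH => e /cP; rewrite !inE /= mem_iota => /andP[-> ].
by rewrite add1n ltnS.
Qed.

Lemma ex_number_attained (l : nat) (V : finType) (H : {set {set V}}) (n : nat) :
  (0 < ex_number l H n)%N ->
  exists G : {set {set 'I_n}},
    [/\ uniform l G, ~~ contains_copy H G & #|G| = ex_number l H n].
Proof.
move=> ex0.
have [|G GP exE] := @eq_bigmax_cond _
    (fun G : {set {set 'I_n}} => uniform l G && ~~ contains_copy H G)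
    (fun G => #|G|).
  rewrite lt0n; apply/negP => /eqP/card0_eq none; move: ex0.
  by rewrite /ex_number big_pred0.
by case/andP: GP => uG freeG; exists G; split.
Qed.

(** * Numerical estimates *)

Lemma ffact_le_exp (n l : nat) : (n ^_ l <= n ^ l)%N.
Proof.
elim: l => [|l IHl]; first by rewrite ffactn0.
by rewrite ffactnSr expnSr leq_mul ?leq_subr.
Qed.

Lemma bin_le_exp (n l : nat) : ('C(n, l) <= n ^ l)%N.
Proof.
by apply: leq_trans (ffact_le_exp n l); rewrite -bin_ffact leq_pmulr ?fact_gt0.
Qed.

Lemma leq_expl (m n e : nat) : (m <= n)%N -> (m ^ e <= n ^ e)%N.
Proof. by case: e => // e le; rewrite leq_exp2r. Qed.

(** For n >= 2 l each of the l factors n - i of the falling factorial is at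
    least n / 2. *)
Lemma exp_le_bin (n l : nat) :
  (2 * l <= n)%N -> (n ^ l <= 2 ^ l * l`! * 'C(n, l))%N.
Proof.
move=> len; have low m : (m <= l -> n ^ m <= 2 ^ m * n ^_ m)%N.
  elim: m => [|m IHm] lem; first by rewrite ffactn0.
  rewrite ffactnSr !expnSr mulnACA leq_mul ?IHm //; first exact: ltnW.
  by lia.
by rewrite -mulnA [(l`! * _)%N]mulnC bin_ffact low.
Qed.

Local Open Scope ring_scope.

Lemma ln_nat_ge0 (R : realType) (n : nat) : 0 <= ln n%:R :> R.
Proof.
by case: n => [|n]; [rewrite ln0 | rewrite ln_ge0 // ler1n].
Qed.

Lemma ln_nat_le (R : realType) (m n : nat) :
  (m <= n)%N -> ln m%:R <= ln n%:R :> R.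
Proof.
case: m => [|m] lemn; first by rewrite ln0 // ln_nat_ge0.
by rewrite ler_ln ?ler_nat // posrE ltr0n //; apply: leq_trans lemn.
Qed.

Lemma ln_nat_exp (R : realType) (n d : nat) :
  ln (n ^ d)%:R = d%:R * ln n%:R :> R.
Proof.
case: n => [|n]; last by rewrite natrX lnXn ?ltr0n // mulr_natl.
rewrite [ln 0%:R]ln0 // mulr0; case: d => [|d]; first by rewrite expn0 ln1.
by rewrite exp0n // ln0.
Qed.

Lemma ln2_le1 (R : realType) : ln 2 <= 1 :> R.
Proof. by have := @le_ln1Dx R 1; rewrite -[1 + 1]/2; apply; lra. Qed.

(** M (1 - g/m)^k <= M exp (- k g/m), and the hypothesis makes this less
    than 1.  The left-hand side is the expected number of M objects missed by k
    independent trials that each hit a given object with probability g/m. *)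
Lemma expected_misses_lt1 (R : realType) (M g m k : nat) :
  (0 < m)%N -> (g <= m)%N -> ln M%:R < k%:R * (g%:R / m%:R) :> R ->
  (M * (m - g) ^ k < m ^ k)%N.
Proof.
move=> m0 gm ltln; have [->|M0] := posnP M; first by rewrite mul0n expn_gt0 m0.
have mR : 0 < m%:R :> R by rewrite ltr0n.
rewrite -(ltr_nat R) natrM !natrX natrB //.
rewrite -[ltRHS]mul1r -ltr_pdivrMr ?exprn_gt0 // -mulrA -expr_div_n mulrBl.
rewrite divff ?gt_eqF //.
have MR : 0 < M%:R :> R by rewrite ltr0n.
rewrite mulrC -ltr_pdivlMr // mul1r.
apply: (@le_lt_trans _ _ (expR (- (g%:R / m%:R)) ^+ k)).
  rewrite lerXn2r ?nnegrE ?expR_ge0 //; last exact: expR_ge1Dx.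
  by rewrite subr_ge0 ler_pdivrMr // mul1r ler_nat.
rewrite -expRM_natl -[ltRHS]lnK ?posrE ?invr_gt0 // lnV ?posrE //.
by rewrite ltr_expR mulrN ltrN2.
Qed.

(** * Comparison of list Ramsey and Ramsey numbers *)

(** Absorbs the factors l and r + 1 of [ramsey_of_partite] into powers of k,
    using l <= 2^l <= k^l and likewise for r + 1.  The parts get size
    r + 1 so that they are nonempty even for r = 0. *)
Definition ramsey_exponent (r l : nat) : nat :=
  (l + r.+2 * box_exponent r.+1 l)%N.

Lemma partite_weaken (l r r' : nat) (V : finType) (H : {set {set V}}) :
  (r <= r')%N -> partite_with_parts_le l r H -> partite_with_parts_le l r' H.
Proof.
by move=> le [p [? small]]; exists p; split=> // i; apply: leq_trans le.
Qed.

Lemma ramsey_polynomial (l r : nat) (V : finType) (H : {set {set V}})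
    (k m n : nat) :
  uniform l H -> partite_with_parts_le l r H -> (2 <= k)%N -> (0 < m <= k)%N ->
  (k ^ ramsey_exponent r l <= n)%N -> ramsey_property l H m n.
Proof.
move=> uH parH k2 /andP[m0 mk] len.
apply: (ramsey_of_partite uH (partite_weaken (leqnSn r) parH)) => //.
have le_exp a : (a <= k ^ a)%N by apply/ltnW/ltn_expl.
apply: leq_trans len; rewrite expnD leq_mul // expnM leq_expl //.
by rewrite expnSr leq_mul.
Qed.

(** With D the exponent of the polynomial bound, either n >= k^D and the bound
    applies, or the number of edges is at most k^(l D).  In the second case
    the hypothesis on m gives k / m >= (l D + 1) ln k, which beats the
    logarithm of the number of edges, as [ramsey_of_list] requires. *)
Lemma list_to_ramsey (R : realType) (l r : nat) (V : finType)
    (H : {set {set V}}) (k m n : nat) :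
  uniform l H -> partite_with_parts_le l r H -> (2 <= k)%N ->
  m%:R <= ln 2 / (l * ramsey_exponent r l).+1%:R * k%:R / ln k%:R :> R ->
  list_ramsey_property l H k n -> ramsey_property l H m n.
Proof.
move=> uH parH k2; set D := ramsey_exponent r l => lem listH.
(* Without edges every colouring is a colouring from the lists. *)
have [K0|[e0 e0K]] := set_0Vmem (complete l n).
  case: listH => L [_ LP] c cP; apply: LP => e; by rewrite K0 inE.
have [m0|m_gt0] := posnP m.
  by move=> c /(_ e0 e0K); rewrite m0; case: (c e0).
have M0 : (0 < 'C(n, l))%N.
  by rewrite -card_complete; apply/card_gt0P; exists e0.
have ln2 : 0 < ln 2 :> R by rewrite ln_gt0 // ltr1n.
have lnk : ln 2 <= ln k%:R :> R by apply: (@ln_nat_le R 2 k).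
have lnk0 : 0 < ln k%:R :> R := lt_le_trans ln2 lnk.
have kR : 0 < k%:R :> R by rewrite ltr0n; apply: leq_trans k2.
have mlnk : m%:R * ln k%:R * (l * D).+1%:R <= ln 2 * k%:R :> R.
  move: lem; rewrite ler_pdivlMr // => lem.
  by rewrite -ler_pdivlMr ?ltr0n // mulrAC.
have mk : (m <= k)%N.
  rewrite -(ler_nat R) -(ler_pM2r lnk0); apply: (@le_trans _ _ (ln 2 * k%:R)).
    apply: le_trans mlnk; rewrite ler_peMr ?ler1n //.
    by rewrite mulr_ge0 // ltW.
  by rewrite mulrC ler_wpM2l // ltW.
have [len|ltn] := leqP (k ^ D) n.
  by apply: (ramsey_polynomial uH parH k2 _ len); rewrite m_gt0 mk.
apply: (ramsey_of_list uH m_gt0 _ listH); rewrite -subn1.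
apply: (@expected_misses_lt1 R _ 1) => //.
have lnM : ln ('C(n, l))%:R <= (l * D)%:R * ln k%:R :> R.
  rewrite -ln_nat_exp; apply: ln_nat_le; apply: leq_trans (bin_le_exp n l) _.
  by rewrite mulnC expnM leq_expl // ltnW.
apply: le_lt_trans lnM _; rewrite mul1r ltr_pdivlMr ?ltr0n //.
apply: (@lt_le_trans _ _ (m%:R * ln k%:R * (l * D).+1%:R)).
  rewrite -[ltLHS]mulrA [ltLHS]mulrC [ln _ * m%:R]mulrC.
  by rewrite ltr_pM2l ?mulr_gt0 ?ltr0n // ltr_nat.
by apply: le_trans mlnk _; rewrite ler_piMl ?ln2_le1 // ltW.
Qed.

(** * Comparison up to logarithmic factors *)

Definition soft_le (R : realType) (f g : nat -> R) : Prop :=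
  exists (C : R) (a : nat), 0 < C /\
    \forall n \near \oo%classic, f n <= C * ln n%:R ^+ a * g n.

Lemma ln_nat_unbounded (R : realType) (A : R) :
  \forall n \near \oo%classic, A <= ln n%:R.
Proof.
near=> n; rewrite -[A]expRK ler_ln ?posrE ?expR_gt0 //.
  by near: n; exact: nbhs_infty_ger.
by rewrite ltr0n; near: n; exact: nbhs_infty_ge.
Unshelve. all: by end_near. Qed.

Lemma soft_le_exponent (R : realType) (C C' L x : R) (a a' : nat) :
  0 <= C -> C <= C' -> (a <= a')%N -> 1 <= L -> 0 <= x ->
  C * L ^+ a * x <= C' * L ^+ a' * x.
Proof.
move=> C0 CC' aa' L1 x0; rewrite ler_wpM2r // ler_pM //.
  by rewrite exprn_ge0 // (le_trans ler01).
exact: ler_weXn2l.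
Qed.

Lemma soft_theta_of_le (R : realType) (f g : nat -> R) :
  (forall n, 0 <= f n) -> (forall n, 0 <= g n) ->
  soft_le f g -> soft_le g f -> soft_theta f g.
Proof.
move=> f0 g0 [C [a [C0 fg]]] [C' [a' [C'0 gf]]].
exists (Num.max C C'), (maxn a a'); split; first by rewrite lt_max C0.
near=> n; have L1 : 1 <= ln n%:R :> R by near: n; exact: ln_nat_unbounded.
split.
  apply: (@le_trans _ _ (C * ln n%:R ^+ a * g n)); first by near: n.
  by apply: soft_le_exponent; rewrite ?le_max ?lexx ?leq_maxl // ltW.
apply: (@le_trans _ _ (C' * ln n%:R ^+ a' * f n)); first by near: n.
by apply: soft_le_exponent; rewrite ?le_max ?lexx ?leq_maxr ?orbT // ltW.
Unshelve. all: by end_near. Qed.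

Lemma soft_le_trans (R : realType) (f g h : nat -> R) :
  soft_le f g -> soft_le g h -> soft_le f h.
Proof.
move=> [C [a [C0 fg]]] [C' [a' [C'0 gh]]].
exists (C * C'), (a + a')%N; split; first exact: mulr_gt0.
near=> n; have L0 : 0 <= ln n%:R :> R := ln_nat_ge0 R n.
apply: (@le_trans _ _ (C * ln n%:R ^+ a * g n)); first by near: n.
rewrite exprD [C * C' * _]mulrACA -[leRHS]mulrA.
rewrite ler_wpM2l ?mulr_ge0 ?exprn_ge0 ?(ltW C0) //.
by near: n.
Unshelve. all: by end_near. Qed.

Lemma soft_le_of_le (R : realType) (f g : nat -> R) :
  (\forall n \near \oo%classic, f n <= g n) -> soft_le f g.
Proof.
move=> fg; exists 1, 0%N; split=> //; near=> n.
by rewrite expr0 !mul1r; near: n.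
Unshelve. all: by end_near. Qed.

(** The real power a / eps of L is rounded up to an integer power, which
    L >= 1 permits, so that the root of a comparison up to logarithmic factors
    is again one. *)
Lemma powR_root (R : realType) (eps x y K L : R) (a : nat) :
  0 < eps -> 0 <= x -> 0 <= y -> 0 <= K -> 1 <= L -> x <= K * L ^+ a * y ->
  x `^ (1 / eps) <=
    K `^ (1 / eps) * L ^+ (Num.truncn (a%:R / eps)).+1 * y `^ (1 / eps).
Proof.
move=> e0 x0 y0 K0 L1 le; have L0 : 0 <= L := le_trans ler01 L1.
have La0 : 0 <= L ^+ a by rewrite exprn_ge0.
have inv0 : 0 <= 1 / eps by rewrite mul1r invr_ge0 ltW.
apply: (@le_trans _ _ ((K * L ^+ a * y) `^ (1 / eps))).
  by rewrite ge0_ler_powR // nnegrE // !mulr_ge0.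
rewrite !powRM ?mulr_ge0 // ler_wpM2r ?powR_ge0 // ler_wpM2l ?powR_ge0 //.
rewrite -!powR_mulrn // -powRrM ler_powR // mulrA mulr1.
exact/ltW/truncnS_gt.
Qed.

(** * Order of magnitude of the Ramsey numbers *)

Lemma ramsey_exists (l r : nat) (V : finType) (H : {set {set V}}) (k : nat) :
  uniform l H -> partite_with_parts_le l r H -> (2 <= k)%N ->
  exists n, ramsey_property l H k n.
Proof.
move=> uH parH k2; exists (k ^ ramsey_exponent r l)%N.
apply: (ramsey_polynomial uH parH k2 _ (leqnn _)).
by rewrite leqnn (ltnW k2).
Qed.

Lemma ramsey_le_exp (l r : nat) (V : finType) (H : {set {set V}}) (k : nat) :
  uniform l H -> partite_with_parts_le l r H -> (2 <= k)%N ->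
  (ramsey l H k <= k ^ ramsey_exponent r l)%N.
Proof.
move=> uH parH k2; apply: least_le.
apply: (ramsey_polynomial uH parH k2 _ (leqnn _)).
by rewrite leqnn (ltnW k2).
Qed.

Lemma ln_ramsey_le (R : realType) (l r : nat) (V : finType)
    (H : {set {set V}}) (k q : nat) :
  uniform l H -> partite_with_parts_le l r H -> (2 <= k)%N ->
  (q <= ramsey l H k)%N ->
  ln q%:R <= (ramsey_exponent r l)%:R * ln k%:R :> R.
Proof.
move=> uH parH k2 le; rewrite -ln_nat_exp; apply: ln_nat_le.
exact: leq_trans le (ramsey_le_exp uH parH k2).
Qed.

Lemma powR_split (R : realType) (eps : R) (l n : nat) : (0 < n)%N ->
  n%:R ^+ l = n%:R `^ (l%:R - eps) * n%:R `^ eps :> R.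
Proof.
move=> n0; rewrite -powR_mulrn ?ler0n // -powRD ?subrK //.
by apply/implyP => _; rewrite pnatr_eq0 -lt0n.
Qed.

(** The Ramsey property fails at n, one less than the Ramsey number, so
    'C(n, l) <= k ex(H, n).  Since 'C(n, l) is of order n^l and ex(H, n) is at
    most n^(l - eps) up to logarithms, n^eps is at most k times a power of
    ln n, and ln n is O(ln k) by the polynomial bound. *)
Lemma ramsey_soft_upper (R : realType) (l r : nat) (V : finType)
    (H : {set {set V}}) (eps : R) :
  uniform l H -> partite_with_parts_le l r H -> 0 < eps ->
  soft_le (fun n => (ex_number l H n)%:R : R)
          (fun n => n%:R `^ (l%:R - eps)) ->
  soft_le (fun k => (ramsey l H k)%:R : R) (fun k => k%:R `^ (1 / eps)).
Proof.
move=> uH parH eps_gt0 [C [a [C_gt0 [N _ exle]]]].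
pose D := ramsey_exponent r l; pose b := (Num.truncn (a%:R / eps)).+1.
pose K : R := (2 ^ l * l`!)%:R * C * D%:R ^+ a.
have K0 : 0 <= K by rewrite !mulr_ge0 ?exprn_ge0 // ltW.
pose N' := (N + 2 * l).+2; pose C' := N'%:R + 2 * K `^ (1 / eps).
have C'0 : 0 < C' by rewrite ltr_wpDr ?ltr0n // mulr_ge0 // powR_ge0.
exists C', b; split=> //; near=> k.
have k2 : (2 <= k)%N by near: k; exact: nbhs_infty_ge.
have L1 : 1 <= ln k%:R :> R by near: k; exact: ln_nat_unbounded.
have L0 : 0 <= ln k%:R :> R := le_trans ler01 L1.
have Lb1 : 1 <= ln k%:R ^+ b :> R by rewrite exprn_ege1.
have kpow1 : 1 <= k%:R `^ (1 / eps) :> R.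
  rewrite -[leLHS](powRr0 k%:R) ler_powR ?ler1n ?(ltnW k2) //.
  by rewrite mul1r invr_ge0 ltW.
(* Below N' the hypothesis on ex(H, n) or the bound on 'C(n, l) may fail, but
   then a constant bounds the Ramsey number. *)
have [small|big] := leqP (ramsey l H k) N'.
  apply: (@le_trans _ _ (C' * 1 * 1)); last first.
    by rewrite !ler_pM ?mulr_ge0 ?ler01 // ltW.
  rewrite !mulr1 (@le_trans _ _ N'%:R) ?ler_nat // lerDl mulr_ge0 //.
  exact: powR_ge0.
set q := ramsey l H k in big *; pose n := q.-1.
have qE : q = n.+1 by rewrite /n prednK // (leq_trans _ big).
have n0 : (0 < n)%N by lia.
have nR : 0 < n%:R :> R by rewrite ltr0n.
have dens : ('C(n, l) <= k * ex_number l H n)%N.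
  rewrite leqNgt; apply/negP => /ramsey_of_density/least_le.
  by rewrite -/(ramsey l H k) -/q qE ltnn.
have key : n%:R `^ eps <= K * ln k%:R ^+ a * k%:R.
  have exn : n%:R ^+ l <= (2 ^ l * l`!)%:R * (k%:R * (ex_number l H n)%:R) :> R.
    rewrite -natrX -!natrM ler_nat.
    apply: leq_trans (exp_le_bin _) _; first lia.
    by rewrite leq_mul2l dens orbT.
  have lnn : ln n%:R ^+ a <= (D%:R * ln k%:R) ^+ a :> R.
    rewrite lerXn2r ?nnegrE ?ln_nat_ge0 ?mulr_ge0 //.
    by apply: (ln_ramsey_le R uH parH) => //; rewrite -/q qE.
  have np : 0 < n%:R `^ (l%:R - eps) :> R by rewrite powR_gt0.
  rewrite -(ler_pM2l np) -powR_split //; apply: le_trans exn _.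
  apply: (@le_trans _ _ ((2 ^ l * l`!)%:R *
      (k%:R * (C * (D%:R * ln k%:R) ^+ a * n%:R `^ (l%:R - eps))))).
    rewrite !ler_wpM2l // (le_trans (exle n _)) //; first by rewrite /=; lia.
    by rewrite ler_wpM2r ?powR_ge0 // ler_wpM2l // ltW.
  by rewrite /K exprMn le_eqVlt; apply/orP; left; apply/eqP; ring.
have root := powR_root eps_gt0 (powR_ge0 _ _) (ler0n _ k) K0 L1 key.
rewrite -powRrM mulrCA divff ?gt_eqF // mulr1 powRr1 // in root.
apply: (@le_trans _ _ (2 * n%:R)).
  by rewrite -natrM ler_nat; lia.
apply: (@le_trans _ _
  (2 * (K `^ (1 / eps) * ln k%:R ^+ b * k%:R `^ (1 / eps)))).
  by rewrite ler_wpM2l.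
rewrite !mulrA ler_wpM2r ?powR_ge0 // ler_wpM2r ?exprn_ge0 //.
by rewrite lerDr ler0n.
Unshelve. all: by end_near. Qed.

Lemma ex_number_le_bin (l : nat) (V : finType) (H : {set {set V}}) (n : nat) :
  (ex_number l H n <= 'C(n, l))%N.
Proof.
apply/bigmax_leqP => G /andP[/forall_inP uG _]; rewrite -card_complete.
by apply: subset_leq_card; apply/fintype.subsetP => e /uG; rewrite inE.
Qed.

(** Otherwise k random permuted images of an extremal hypergraph would miss
    fewer than one edge on average, against [copy_free_cover_bound]. *)
Lemma ramsey_colours_le (R : realType) (l : nat) (V : finType)
    (H : {set {set V}}) (k n : nat) :
  (0 < ex_number l H n)%N -> ramsey_property l H k n ->
  k%:R * (ex_number l H n)%:R <= ('C(n, l))%:R * ln ('C(n, l))%:R :> R.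
Proof.
move=> ex0 ramH; have [G [uG freeG cardG]] := ex_number_attained ex0.
have M0 := leq_trans ex0 (ex_number_le_bin l H n).
have := copy_free_cover_bound uG freeG ramH; apply: contraLR.
rewrite -ltNge -ltnNge => lt; apply: (@expected_misses_lt1 R) => //.
  by rewrite cardG ex_number_le_bin.
by rewrite cardG mulrA ltr_pdivlMr ?ltr0n // mulrC.
Qed.

(** At the Ramsey number q of k, k ex(H, q) <= 'C(q, l) ln 'C(q, l).  Since
    'C(q, l) <= q^l and ex(H, q) is at least q^(l - eps) up to logarithms, k is
    at most q^eps times a power of ln q, and ln q is O(ln k). *)
Lemma ramsey_soft_lower (R : realType) (l r : nat) (V : finType)
    (H : {set {set V}}) (eps : R) :
  uniform l H -> partite_with_parts_le l r H -> 0 < eps ->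
  soft_le (fun n => n%:R `^ (l%:R - eps))
          (fun n => (ex_number l H n)%:R : R) ->
  soft_le (fun k => k%:R `^ (1 / eps)) (fun k => (ramsey l H k)%:R : R).
Proof.
move=> uH parH eps_gt0 [C [a [C_gt0 [N _ lexn]]]]; set D := ramsey_exponent r l.
have ex_gt0 n : (N < n)%N -> (0 < ex_number l H n)%N.
  move=> Nn; rewrite lt0n; apply/negP => /eqP ex0.
  have := lexn n (ltnW Nn); rewrite ex0 mulr0 leNgt powR_gt0 // ltr0n.
  exact: leq_ltn_trans Nn.
pose K : R := C * l%:R * D%:R ^+ a.+1.
have K0 : 0 <= K by rewrite !mulr_ge0 ?exprn_ge0 // ltW.
exists (K `^ (1 / eps) + 1), (Num.truncn (a.+1%:R / eps)).+1.
split; first by rewrite ltr_wpDl ?powR_ge0.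
near=> k; pose M := 'C(N.+1, l).
have k2 : (2 <= k)%N by near: k; exact: nbhs_infty_ge.
have L1 : 1 <= ln k%:R :> R by near: k; exact: ln_nat_unbounded.
have L0 : 0 <= ln k%:R :> R := le_trans ler01 L1.
have kM : M%:R * ln M%:R + 1 <= k%:R :> R by near: k; exact: nbhs_infty_ger.
set q := ramsey l H k.
have ramH : ramsey_property l H k q := least_spec (ramsey_exists uH parH k2).
(* The hypothesis on ex(H, q) needs q > N.  Otherwise the Ramsey property would
   hold at N + 1, where k is bounded by a constant. *)
have Nq : (N < q)%N.
  rewrite ltnNge; apply/negP => /leqW qN.
  have ramN := ramsey_property_mono uH qN ramH.
  have := ramsey_colours_le R (ex_gt0 _ (ltnSn N)) ramN.
  apply/negP; rewrite -ltNge.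
  apply: (@lt_le_trans _ _ k%:R); first by rewrite (lt_le_trans _ kM) // ltrDl.
  by rewrite ler_peMr // ler1n ex_gt0.
have qR : 0 < q%:R :> R by rewrite ltr0n; apply: leq_ltn_trans Nq.
have key : k%:R <= K * ln k%:R ^+ a.+1 * q%:R `^ eps.
  have qp : 0 < q%:R `^ (l%:R - eps) :> R by rewrite powR_gt0.
  rewrite -(ler_pM2l qp).
  have lnq : ln q%:R <= D%:R * ln k%:R :> R.
    exact: (ln_ramsey_le R uH parH k2 (leqnn _)).
  have lnq0 := ln_nat_ge0 R q.
  have binq : ('C(q, l))%:R * ln ('C(q, l))%:R <=
      q%:R ^+ l * (l%:R * ln q%:R) :> R.
    rewrite -natrX -(ln_nat_exp R q l).
    rewrite ler_pM ?ln_nat_ge0 ?ler0n ?ler_nat ?bin_le_exp //.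
    by rewrite ln_nat_le ?bin_le_exp.
  have cols := le_trans (ramsey_colours_le R (ex_gt0 q Nq) ramH) binq.
  apply: (@le_trans _ _ (C * ln q%:R ^+ a * (k%:R * (ex_number l H q)%:R))).
    rewrite [X in _ <= X]mulrCA mulrC ler_wpM2l //.
    by apply: lexn; apply: ltnW.
  apply: (@le_trans _ _ (C * ln q%:R ^+ a * (q%:R ^+ l * (l%:R * ln q%:R)))).
    by rewrite ler_wpM2l // mulr_ge0 ?exprn_ge0 // ltW.
  rewrite (powR_split eps) -?(ltr0n R) //.
  have -> : C * ln q%:R ^+ a *
      (q%:R `^ (l%:R - eps) * q%:R `^ eps * (l%:R * ln q%:R)) =
      q%:R `^ (l%:R - eps) * (C * l%:R * ln q%:R ^+ a.+1 * q%:R `^ eps).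
    by rewrite exprS; ring.
  rewrite ler_wpM2l ?powR_ge0 // ler_wpM2r ?powR_ge0 //.
  rewrite /K -!mulrA ler_wpM2l ?(ltW C_gt0) // ler_wpM2l // -exprMn.
  by rewrite lerXn2r ?nnegrE ?mulr_ge0.
have root := powR_root eps_gt0 (ler0n _ k) (powR_ge0 _ _) K0 L1 key.
rewrite -powRrM mulrCA divff ?gt_eqF // mulr1 powRr1 // in root.
apply: le_trans root _; rewrite ler_wpM2r // ler_wpM2r ?exprn_ge0 //.
by rewrite lerDl.
Unshelve. all: by end_near. Qed.

Lemma list_ramsey_le (l r : nat) (V : finType) (H : {set {set V}}) (k : nat) :
  uniform l H -> partite_with_parts_le l r H -> (2 <= k)%N ->
  (list_ramsey l H k <= ramsey l H k)%N.
Proof.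
move=> uH parH k2; apply/least_le/list_of_ramsey.
exact: least_spec (ramsey_exists uH parH k2).
Qed.

(** Random maps to c k / ln k colours fail for a given edge with probability at
    most k^(-1 / c).  The denominator exceeds l D, so that k^(1 / c) exceeds the
    number of edges on fewer than k^D vertices, D being the exponent of the
    polynomial bound; the numerator makes c <= ln 2 <= ln k, so
    that c k / ln k <= k. *)
Definition list_constant (R : realType) (l r : nat) : R :=
  ln 2 / (l * ramsey_exponent r l).+1%:R.

Lemma list_constant_gt0 (R : realType) (l r : nat) : 0 < list_constant R l r.
Proof. by rewrite divr_gt0 ?ltr0n // ln_gt0 // ltr1n. Qed.

Lemma list_constant_le1 (R : realType) (l r : nat) : list_constant R l r <= 1.
Proof.
rewrite ler_pdivrMr ?ltr0n // mul1r (le_trans (ln2_le1 R)) //.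
by rewrite ler1n.
Qed.

Lemma ramsey_le_list (R : realType) (l r : nat) (V : finType)
    (H : {set {set V}}) (k : nat) :
  uniform l H -> partite_with_parts_le l r H -> (2 <= k)%N ->
  (ramsey l H (Num.truncn (list_constant R l r * k%:R / ln k%:R)) <=
   list_ramsey l H k)%N.
Proof.
move=> uH parH k2; apply/least_le/(list_to_ramsey uH parH k2 (R := R)).
  rewrite truncn_le divr_ge0 ?ln_nat_ge0 // mulr_ge0 // ltW //.
  exact: list_constant_gt0.
apply: least_spec; have [n ramH] := ramsey_exists uH parH k2.
by exists n; apply: list_of_ramsey.
Qed.

Lemma ln_le_sqrt (R : realType) (x : R) : 0 < x -> ln x <= 2 * Num.sqrt x.
Proof.
move=> x0; have s0 : 0 < Num.sqrt x by rewrite sqrtr_gt0.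
rewrite -{1}(sqr_sqrtr (ltW x0)) lnXn // -[leLHS]mulr_natl ler_pM2l //.
exact/ltW/ln_sublinear.
Qed.

Lemma div_ln_unbounded (R : realType) (c A : R) : 0 < c ->
  \forall k \near \oo%classic, A <= c * k%:R / ln k%:R.
Proof.
move=> c0; near=> k.
have L1 : 1 <= ln k%:R :> R by near: k; exact: ln_nat_unbounded.
have k0 : 0 < k%:R :> R by rewrite ltr0n; near: k; exact: nbhs_infty_gt.
have s0 : 0 < Num.sqrt k%:R :> R by rewrite sqrtr_gt0.
rewrite ler_pdivlMr ?(lt_le_trans ltr01) //.
have [A0|A0] := leP A 0.
  by rewrite (@le_trans _ _ 0) ?mulr_le0_ge0 ?ln_nat_ge0 // mulr_ge0 // ltW.
apply: (@le_trans _ _ (A * (2 * Num.sqrt k%:R))).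
  by rewrite ler_wpM2l ?ln_le_sqrt // ltW.
have As : 2 * A / c <= Num.sqrt k%:R.
  rewrite -(@ler_sqr R) ?nnegrE ?sqrtr_ge0 //; last first.
    by rewrite divr_ge0 ?mulr_ge0 ?(ltW A0) ?(ltW c0).
  by rewrite sqr_sqrtr ?(ltW k0) //; near: k; exact: nbhs_infty_ger.
rewrite ler_pdivrMr // in As.
rewrite -[X in c * X]sqr_sqrtr ?(ltW k0) // expr2 !mulrA.
rewrite ler_wpM2r ?(ltW s0) //.
by rewrite mulrC [c * _]mulrC.
Unshelve. all: by end_near. Qed.

(** The list Ramsey number of k is at least the Ramsey number of
    m = floor (c k / ln k), and k <= (2 / c) m ln k; so k^(1 / eps) and
    m^(1 / eps) differ by logarithms only. *)
Lemma list_ramsey_soft_lower (R : realType) (l r : nat) (V : finType)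
    (H : {set {set V}}) (eps : R) :
  uniform l H -> partite_with_parts_le l r H -> 0 < eps ->
  soft_le (fun k => k%:R `^ (1 / eps)) (fun k => (ramsey l H k)%:R : R) ->
  soft_le (fun k => k%:R `^ (1 / eps)) (fun k => (list_ramsey l H k)%:R : R).
Proof.
move=> uH parH eps_gt0 [C [a [C_gt0 [J _ lowJ]]]].
set c := list_constant R l r; have c_gt0 : 0 < c := list_constant_gt0 R l r.
pose b := (Num.truncn (1%:R / eps)).+1.
exists ((2 / c) `^ (1 / eps) * C), (b + a)%N; split.
  by rewrite mulr_gt0 // powR_gt0 // divr_gt0.
near=> k; pose x := c * k%:R / ln k%:R; pose m := Num.truncn x.
have k2 : (2 <= k)%N by near: k; exact: nbhs_infty_ge.
have L1 : 1 <= ln k%:R :> R by near: k; exact: ln_nat_unbounded.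
have L0 : 0 <= ln k%:R :> R := le_trans ler01 L1.
have xJ : J.+1%:R <= x by rewrite /x; near: k; exact: div_ln_unbounded.
have x0 : 0 <= x := le_trans (ler0n _ _) xJ.
have Jm : (J < m)%N by rewrite truncn_ge_nat.
have mx : m%:R <= x by rewrite truncn_le.
have xm : x <= 2 * m%:R.
  apply: (@le_trans _ _ m.+1%:R); first exact/ltW/truncnS_gt.
  by rewrite -natrM ler_nat mul2n -addnn -addn1 leq_add2l (leq_ltn_trans _ Jm).
have km : k%:R <= 2 / c * ln k%:R ^+ 1 * m%:R.
  have := xm; rewrite /x ler_pdivrMr ?(lt_le_trans ltr01) // => xm'.
  have -> : 2 / c * ln k%:R ^+ 1 * m%:R = 2 * m%:R * ln k%:R / c by ring.
  by rewrite ler_pdivlMr // mulrC.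
have c2 : 0 <= 2 / c by rewrite divr_ge0 // ltW.
have root := powR_root eps_gt0 (ler0n _ k) (ler0n _ m) c2 L1 km.
apply: le_trans root _; rewrite exprD [X in _ <= X * _]mulrACA -[leRHS]mulrA.
rewrite ler_wpM2l ?mulr_ge0 ?powR_ge0 ?exprn_ge0 //.
apply: le_trans (lowJ m (ltnW Jm)) _.
rewrite ler_pM ?mulr_ge0 ?exprn_ge0 ?ln_nat_ge0 ?(ltW C_gt0) //; last first.
  by rewrite ler_nat; exact: ramsey_le_list.
rewrite ler_wpM2l ?(ltW C_gt0) // lerXn2r ?nnegrE ?ln_nat_ge0 //.
apply: ln_nat_le; rewrite -(ler_nat R) (le_trans mx) //.
rewrite /x ler_pdivrMr ?(lt_le_trans ltr01) // mulrC ler_wpM2l //.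
exact: le_trans (list_constant_le1 R l r) L1.
Unshelve. all: by end_near. Qed.

Theorem theorem8 (R : realType) (l r : nat) :
  exists c : R, 0 < c /\
    forall (V : finType) (H : {set {set V}}),
      uniform l H -> partite_with_parts_le l r H ->
      (forall k : nat, (2 <= k)%N ->
         (ramsey l H (Num.truncn (c * k%:R / ln k%:R)) <= list_ramsey l H k)%N /\
         (list_ramsey l H k <= ramsey l H k)%N) /\
      (forall eps : R, 0 < eps ->
         soft_theta (fun n : nat => (ex_number l H n)%:R : R)
                    (fun n : nat => n%:R `^ (l%:R - eps)) ->
         soft_theta (fun k : nat => (list_ramsey l H k)%:R : R)
                    (fun k : nat => (ramsey l H k)%:R) /\
         soft_theta (fun k : nat => (ramsey l H k)%:R : R)
                    (fun k : nat => k%:R `^ (1 / eps))).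
Proof.
exists (list_constant R l r); split; first exact: list_constant_gt0.
move=> V H uH parH; split=> [k k2|eps eps_gt0 [C [a [C_gt0 ex_theta]]]].
  by split; [apply: ramsey_le_list | apply: list_ramsey_le parH k2].
have upper :
    soft_le (fun k => (ramsey l H k)%:R : R) (fun k => k%:R `^ (1 / eps)).
  apply: (ramsey_soft_upper uH parH eps_gt0); exists C, a; split=> //.
  by apply: filterS ex_theta => n [].
have lower :
    soft_le (fun k => k%:R `^ (1 / eps)) (fun k => (ramsey l H k)%:R : R).
  apply: (ramsey_soft_lower uH parH eps_gt0); exists C, a; split=> //.
  by apply: filterS ex_theta => n [].
split; apply: soft_theta_of_le => //; try by move=> n; apply: powR_ge0.
  apply: soft_le_of_le; near=> k; rewrite ler_nat.
  by apply: list_ramsey_le uH parH _; near: k; exact: nbhs_infty_ge.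
apply: soft_le_trans upper _.
exact: list_ramsey_soft_lower uH parH eps_gt0 lower.
Unshelve. all: by end_near. Qed.
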